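(* As an abelian group under $\otimes$, the wave closure space decomposes as $$\mathcal{G}\;\cong\;\bigoplus_{p\in\mathbb{P}}\bigl(\mathbb{Z}(p^\infty)\oplus\mathbb{Z}(p^\infty)\bigr),$$ where $\mathbb{P}$ is the set of all prime numbers and $\mathbb{Z}(p^\infty)\cong\mathbb{Z}[1/p]/\mathbb{Z}$ is the Prüfer $p$-group, i.e. the group of all $p$-power roots of unity under multiplication.
   Context: Let $\mathcal{F}(\mathbb{Z},\mathbb{R})$ be the additive group of all functions $\theta:\mathbb{Z}\to\mathbb{R}$ (phase configurations) and let $\mathbb{T}^{\mathbb{Z}}$ be the set of sequences $u:\mathbb{Z}\to\mathbb{C}$ with $|u[m]|=1$ for all $m$. The projection $\pi:\mathcal{F}(\mathbb{Z},\mathbb{R})\to\mathbb{T}^{\mathbb{Z}}$ is $\pi(\theta)[m]=\exp(2\pi i\,\theta[m])$. The pointwise product is $(u\otimes v)[m]=u[m]v[m]$. The primitive phase generators are $\Theta_Z[m]=m$ and $\Theta_{\bar 1}[m]=1$ for all $m\in\mathbb{Z}$. On phase configurations consider the operations: addition $\theta_1+\theta_2$; negation $-\theta$; and, for every integer $n\ge 1$ and every $k\in\{0,\dots,n-1\}$, the $k$-th branch of the $n$-th root, $(\theta^{1/n})_{(k)}[m]=\frac{\theta[m]+k}{n}$. The wave closure space is $\mathcal{G}:=\pi(C)$, where $C$ is the smallest subset of $\mathcal{F}(\mathbb{Z},\mathbb{R})$ containing $\Theta_Z$ and $\Theta_{\bar 1}$ and closed under all these operations. *)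

(* Defs.v *)
From HB Require Import structures.
From mathcomp Require Import all_boot all_order all_algebra.
From mathcomp Require Import complex.
From mathcomp Require Import boolp classical_sets functions cardinality reals.
From mathcomp Require Import trigo.

Set Implicit Arguments.
Unset Strict Implicit.
Unset Printing Implicit Defensive.

Import Order.TTheory GRing.Theory Num.Theory.
Local Open Scope classical_set_scope.
Local Open Scope ring_scope.
Local Open Scope complex_scope.

(* Abelian groups are zmodTypes, so the group law of the circle group below   *)
(* is written additively: for z w : circle R, z + w is the product of the     *)
(* complex numbers z and w, - z is the inverse of z, and 0 is the number 1.   *)
Record circle (R : realType) := Circle {
  circle_val :> R[i];
  circle_norm : `|circle_val| == 1
}.

Section Circle.
Variable R : realType.

HB.instance Definition _ := [isSub for @circle_val R].
HB.instance Definition _ := [Choice of circle R by <:].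

Implicit Types z w : circle R.

Fact circle_norm1 : `|1 : R[i]| == 1.
Proof. by rewrite normr1. Qed.

Fact circle_normM z w : `|(z : R[i]) * w| == 1.
Proof. by rewrite normrM (eqP (circle_norm z)) (eqP (circle_norm w)) mulr1. Qed.

Fact circle_normV z : `|(z : R[i])^-1| == 1.
Proof. by rewrite normfV (eqP (circle_norm z)) invr1. Qed.

Definition circle_one := Circle circle_norm1.
Definition circle_mul z w := Circle (circle_normM z w).
Definition circle_inv z := Circle (circle_normV z).

Fact circle_mulA : associative circle_mul.
Proof. by move=> z w t; apply: val_inj; rewrite /= mulrA. Qed.

Fact circle_mulC : commutative circle_mul.
Proof. by move=> z w; apply: val_inj; rewrite /= mulrC. Qed.

Fact circle_mul1 : left_id circle_one circle_mul.
Proof. by move=> z; apply: val_inj; rewrite /= mul1r. Qed.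

Fact circle_mulV : left_inverse circle_one circle_inv circle_mul.
Proof.
move=> z; apply: val_inj; rewrite /= mulVf // -normr_gt0.
by rewrite (eqP (circle_norm z)) ltr01.
Qed.

HB.instance Definition _ := GRing.isZmodule.Build (circle R)
  circle_mulA circle_mulC circle_mul1 circle_mulV.

Lemma circle_addE z w : circle_val (z + w) = circle_val z * circle_val w.
Proof. by []. Qed.

Lemma circle_oppE z : circle_val (- z) = (circle_val z)^-1.
Proof. by []. Qed.

Lemma circle_zeroE : circle_val 0 = 1.
Proof. by []. Qed.

Lemma circle_mulrnE z n : circle_val (z *+ n) = circle_val z ^+ n.
Proof. by elim: n => [//|n IHn]; rewrite mulrS circle_addE IHn exprS. Qed.

End Circle.

Section Waves.
Variable R : realType.

Fact cis_norm (x : R) : `|cos x +i* sin x| == 1.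
Proof. by rewrite normc_def /= cos2Dsin2 sqrtr1. Qed.

(* exp (2 pi i x), by Euler's formula *)
Definition exp2pii (x : R) : circle R := Circle (cis_norm (2 * pi * x)).

Lemma exp2piiD (x y : R) : exp2pii (x + y) = exp2pii x + exp2pii y.
Proof.
apply: val_inj; rewrite /= mulrDr cosD sinD; simpc.
by congr (_ +i* _); rewrite addrC.
Qed.

Lemma exp2pii0 : exp2pii 0 = 0.
Proof. by apply: (addIr (exp2pii 0)); rewrite -exp2piiD !add0r. Qed.

Lemma exp2piiN (x : R) : exp2pii (- x) = - exp2pii x.
Proof.
by apply: (addIr (exp2pii x)); rewrite -exp2piiD !addNr exp2pii0.
Qed.

Definition phase := int -> R.

Definition theta_Z : phase := fun m => m%:~R.
Definition theta_1 : phase := fun=> 1.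

Definition root_branch (n k : nat) (theta : phase) : phase :=
  fun m => (theta m + k%:R) / n%:R.

Definition phase_closed (S : set phase) : Prop :=
  [/\ forall theta1 theta2 : phase, S theta1 -> S theta2 ->
        S (theta1 \+ theta2),
      forall theta : phase, S theta -> S (\- theta) &
      forall (n k : nat) (theta : phase), (1 <= n)%N -> (k < n)%N ->
        S theta -> S (root_branch n k theta)].

Definition phase_closure : set phase :=
  smallest phase_closed [set theta_Z; theta_1].

(* The group T^Z is the type int -> circle R, whose pointwise group law is    *)
(* the pointwise product of sequences.                                        *)
Definition proj (theta : phase) : int -> circle R :=
  fun m => exp2pii (theta m).

Definition wave_closure : set (int -> circle R) := proj @` phase_closure.

Fact wave_closure_zmod_closed :
  zmod_closed (mem wave_closure : {pred int -> circle R}).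
Proof.
split=> [|u v]; rewrite -?topredE /= ?inE.
  exists (theta_1 \+ (\- theta_1)).
    move=> S [[SD SN _] Sgen]; have S1 : S theta_1 by apply: Sgen; right.
    by apply: SD => //; exact: SN.
  by apply/funext => m; rewrite /proj /= subrr exp2pii0.
move=> [th Cth <-] [ps Cps <-]; exists (th \+ (\- ps)).
  move=> S HS; have [[SD SN _] _] := HS.
  by apply: SD; [exact: Cth|apply: SN; exact: Cps].
by apply/funext => m; rewrite /proj /= exp2piiD exp2piiN.
Qed.

Definition wave_space := {u : int -> circle R | u \in wave_closure}.

HB.instance Definition _ := SubChoice.copy wave_space
  {u : int -> circle R | u \in wave_closure}.
HB.instance Definition _ := GRing.SubChoice_isSubZmodule.Build
  _ _ wave_space wave_closure_zmod_closed.

Lemma wave_addE (u v : wave_space) (m : int) :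
  circle_val (val (u + v) m) = circle_val (val u m) * circle_val (val v m).
Proof. by []. Qed.

End Waves.

Section Prufer.
Variables (R : realType) (p : nat).

(* Roots of unity have modulus 1, so carving the p-power roots of unity out   *)
(* of the circle group loses none of them.                                    *)
Definition prufer_pred : {pred circle R} :=
  fun z => `[< exists n : nat, (p ^ n).-unity_root (circle_val z) >].

Fact prufer_zmod_closed : zmod_closed prufer_pred.
Proof.
split=> [|z w]; rewrite !unfold_in.
  by apply/asboolP; exists 0%N; rewrite expn0 unity_rootE expr1.
move=> /asboolP[n zn] /asboolP[k wk]; apply/asboolP; exists (n + k)%N.
move: zn wk; rewrite !unity_rootE expnD /= => /eqP zn /eqP wk.
rewrite exprMn exprM zn expr1n mul1r.
by rewrite mulnC exprM exprVn wk invr1 expr1n.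
Qed.

Definition prufer := {z : circle R | prufer_pred z}.

HB.instance Definition _ := SubChoice.copy prufer
  {z : circle R | prufer_pred z}.
HB.instance Definition _ := GRing.SubChoice_isSubZmodule.Build
  _ _ prufer prufer_zmod_closed.

Lemma prufer_addE (z w : prufer) :
  circle_val (val (z + w)) = circle_val (val z) * circle_val (val w).
Proof. by []. Qed.

End Prufer.

(* External direct sum: finitely supported elements of the product. *)
Record dirsum (I : Type) (V : I -> zmodType) := DirSum {
  dirsum_val :> forall i, V i;
  dirsum_finite : `[< finite_set [set i | dirsum_val i != 0] >]
}.

Section DirectSum.
Variables (I : Type) (V : I -> zmodType).

HB.instance Definition _ := [isSub for @dirsum_val I V].
HB.instance Definition _ := [Choice of dirsum V by <:].

Implicit Types u v w : dirsum V.

Fact dirsum_finite0 : `[< finite_set [set i | (0 : V i) != 0] >].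
Proof.
apply/asboolP.
by rewrite (_ : [set i | _] = set0) // -subset0 => i /=; rewrite eqxx.
Qed.

Fact dirsum_finiteD u v : `[< finite_set [set i | u i + v i != 0] >].
Proof.
apply/asboolP; have /asboolP fu := dirsum_finite u.
have /asboolP fv := dirsum_finite v.
apply: (@sub_finite_set _ _ ([set i | u i != 0] `|` [set i | v i != 0])).
  move=> i /=; have [->|ui _] := eqVneq (u i) 0; last by left.
  by rewrite add0r; right.
by rewrite finite_setU.
Qed.

Fact dirsum_finiteN u : `[< finite_set [set i | - u i != 0] >].
Proof.
apply/asboolP; have /asboolP := dirsum_finite u.
by apply: sub_finite_set => i /=; rewrite oppr_eq0.
Qed.

Definition dirsum_zero := DirSum dirsum_finite0.
Definition dirsum_add u v := DirSum (dirsum_finiteD u v).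
Definition dirsum_opp u := DirSum (dirsum_finiteN u).

Fact dirsum_addA : associative dirsum_add.
Proof.
by move=> u v w; apply/val_inj/functional_extensionality_dep => i;
  exact: addrA.
Qed.

Fact dirsum_addC : commutative dirsum_add.
Proof.
by move=> u v; apply/val_inj/functional_extensionality_dep => i;
  exact: addrC.
Qed.

Fact dirsum_add0 : left_id dirsum_zero dirsum_add.
Proof.
by move=> u; apply/val_inj/functional_extensionality_dep => i;
  exact: add0r.
Qed.

Fact dirsum_addN : left_inverse dirsum_zero dirsum_opp dirsum_add.
Proof.
by move=> u; apply/val_inj/functional_extensionality_dep => i;
  exact: addNr.
Qed.

HB.instance Definition _ := GRing.isZmodule.Build (dirsum V)
  dirsum_addA dirsum_addC dirsum_add0 dirsum_addN.

Lemma dirsum_addE u v i : (u + v) i = u i + v i.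
Proof. by []. Qed.

End DirectSum.

Definition prime_number := {p : nat | prime p}.

Definition prufer_sum (R : realType) : zmodType :=
  dirsum (fun p : prime_number =>
            (prufer R (val p) * prufer R (val p))%type : zmodType).

(* Main.v *)
Require Import Defs.
From HB Require Import structures.
From mathcomp Require Import all_boot all_order all_algebra complex.
From mathcomp Require Import boolp classical_sets functions cardinality fsbigop.
From mathcomp Require Import reals trigo.
From mathcomp Require Import ring lra.

Set Implicit Arguments.
Unset Strict Implicit.
Unset Printing Implicit Defensive.

Import Order.TTheory GRing.Theory Num.Theory.
Local Open Scope classical_set_scope.
Local Open Scope ring_scope.

(** A phase reachable from [m |-> m] and [m |-> 1] is exactly an affine function
    [m |-> a m + b] with rational [a] and [b]: affine functions with rational
    coefficients are stable under all the operations, and conversely the integer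
    multiples and the zeroth branches of the roots already produce every
    rational multiple of a generator ([phase_closureE]).  After projection, a
    wave is an arithmetic progression [m |-> y + x *~ m] in the circle group,
    whose step [x] and origin [y] are the numbers exp (2 pi i a) and
    exp (2 pi i b).  As exp (2 pi i t) = 1 only for integral [t], and as every
    point of the circle has the form exp (2 pi i t), these are arbitrary roots
    of unity ([torsion_exp2pii], [wave_closureE]).  The progression determines
    its step and origin, so the waves form two copies of the torsion subgroup
    of the circle.

    It remains to split this torsion group into primary parts.  This works for
    every torsion abelian group [A] ([primary_decomposition]): summing the
    components is a morphism from the direct sum of the primary parts to [A];
    Bezout's identity shows that it is onto (an element killed by a product of
    coprime numbers is a sum of elements killed by each factor) and one-to-one
    (an element killed by two coprime numbers vanishes).  The wanted isomorphism
    is the inverse of this sum.  Its hypotheses hold because the waves killed by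
    a power of [p] are the progressions whose step and origin both lie in the
    Pruefer [p]-group ([prufer_wave_image]). *)

(** * Torsion elements of an abelian group *)

Section Torsion.
Variable A : zmodType.
Implicit Types a b : A.

Definition torsion a := exists2 n, (0 < n)%N & a *+ n = 0.

(** If [1 + k n = l m], then [a = - (k n) a + (l m) a], where [m] kills the
    first term and [n] kills the second. *)
Lemma coprime_torsion_split a m n :
  (0 < m)%N -> coprime m n -> a *+ (m * n) = 0 ->
  exists b c, [/\ a = b + c, b *+ m = 0 & c *+ n = 0].
Proof.
move=> m_gt0 co_mn amn0; have [k _] := Bezoutl n m_gt0.
rewrite (eqP co_mn) => /dvdnP[l kl].
exists (- (a *+ (k * n))), (a *+ (l * m)); split.
- by rewrite -kl mulrnDr mulr1n addrCA addNr addr0.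
- by rewrite mulNrn -mulrnA -mulnA mulnC (mulnC n) mulrnA amn0 mul0rn oppr0.
- by rewrite -mulrnA -mulnA mulnC mulrnA amn0 mul0rn.
Qed.

Lemma coprime_torsion_eq0 a m n :
  (0 < m)%N -> coprime m n -> a *+ m = 0 -> a *+ n = 0 -> a = 0.
Proof.
move=> m_gt0 co_mn am0 an0; have [k _] := Bezoutl n m_gt0.
rewrite (eqP co_mn) => /dvdnP[l kl].
have: a *+ (1 + k * n) = 0 by rewrite kl mulnC mulrnA am0 mul0rn.
by rewrite mulrnDr mulnC mulrnA an0 mul0rn addr0 mulr1n.
Qed.

(** Let [p] be the least prime divisor of a number [n > 1] killing an element.
    The factorization of [n] into its [p]-part and the complement writes the
    element as the sum of a [p]-primary one and one killed by a number smaller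
    than [n]. *)
Lemma torsion_primary_ind (P : A -> Prop) :
    P 0 -> (forall a b, P a -> P b -> P (a + b)) ->
    (forall p n a, prime p -> a *+ (p ^ n) = 0 -> P a) ->
  forall a, torsion a -> P a.
Proof.
move=> P0 PD Pp a0 [n]; move: a0; have [k] := ubnP n.
elim: k n => // k IHk n /ltnSE n_le a n_gt0 an0.
have [n_gt1|n_le1] := ltnP 1 n; last first.
  by rewrite -[a]mulr1n (_ : 1%N = n) ?an0 //; apply/eqP; rewrite eqn_leq n_gt0.
set p := pdiv n; have p_pr : prime p by exact: pdiv_prime.
have an0' : a *+ (n`_p * n`_p^') = 0 by rewrite partnC.
have [b [c [-> bp cp]]] :=
  coprime_torsion_split (part_gt0 p n) (coprime_partC p n n) an0'.
apply: PD; first by move: bp; rewrite p_part; exact: Pp.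
apply: IHk cp; last exact: part_gt0.
apply: leq_trans n_le; rewrite -[ltnRHS](partnC p n_gt0) ltn_Pmull ?part_gt0 //.
by rewrite p_part -(expn0 p) ltn_exp2l ?prime_gt1 // logn_gt0 pi_pdiv.
Qed.

End Torsion.

(** * Morphisms out of a direct sum *)

Section DirectSumMap.
Variables (I : choiceType) (V : I -> zmodType) (A : zmodType).
Variable h : forall i, {additive V i -> A}.

Definition dirsum_map (u : dirsum V) : A := \sum_(i \in [set: I]) h i (u i).

(** Additivity compares sums with different supports; this puts them on a
    common finite set. *)
Lemma dirsum_map_widen (S : set I) (u : dirsum V) :
  [set i | u i != 0] `<=` S -> dirsum_map u = \sum_(i \in S) h i (u i).
Proof.
move=> uS; apply/esym/fsbig_widen => // i [_ /= nSi].
have [->|/uS//] := eqVneq (u i) 0; exact: raddf0.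
Qed.

Lemma dirsum_map_zmod_morphism : zmod_morphism dirsum_map.
Proof.
move=> u v.
pose S := [set i | u i != 0] `|` [set i | v i != 0].
have finS : finite_set S.
  by rewrite finite_setU; split; apply/asboolP; exact: dirsum_finite.
have nS i : ~ S i -> u i = 0 /\ v i = 0.
  by move=> /not_orP[/negP/negPn/eqP-> /negP/negPn/eqP->].
have sub (w : dirsum V) : (forall i, u i = 0 -> v i = 0 -> w i = 0) ->
    [set i | w i != 0] `<=` S.
  move=> w0 i; apply: contraPP => /nS[ui vi].
  by rewrite /= w0 // eqxx.
rewrite !(@dirsum_map_widen S); try by apply: sub.
  apply/eqP; rewrite eq_sym subr_eq -fsbig_split //; apply/eqP/eq_fsbigr => i _.
  by rewrite /= -raddfD subrK.
by apply: sub => i ui vi; rewrite -[LHS]/(u i - v i) ui vi subr0.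
Qed.

HB.instance Definition _ :=
  GRing.isZmodMorphism.Build (dirsum V) A dirsum_map dirsum_map_zmod_morphism.

Fact dirsum_single_finite i (x : V i) :
  `[< finite_set [set j | dfwith (fun j => 0 : V j) x j != 0] >].
Proof.
apply/asboolP; apply: sub_finite_set (finite_set1 i) => j /=.
by case: dfwithP => // k _; rewrite eqxx.
Qed.

Definition dirsum_single i (x : V i) := DirSum (dirsum_single_finite x).

Lemma dirsum_map_single i (x : V i) : dirsum_map (dirsum_single x) = h i x.
Proof.
rewrite (@dirsum_map_widen [set i]) ?fsbig_set1 /= ?dfwith_in // => j /=.
by case: dfwithP => // k _; rewrite eqxx.
Qed.

End DirectSumMap.

(** * Primary decomposition *)

(** The primary parts are given up to isomorphism, by embeddings [h p] whose
    images are the [p]-primary parts.  If the components [h p (u p)] sum to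
    zero, then the component at [q] is the opposite of a sum over other primes;
    it is killed both by a power of [q] and by a number coprime to [q], hence
    is zero. *)
Theorem primary_decomposition (A : zmodType) (V : prime_number -> zmodType)
    (h : forall p, {additive V p -> A}) :
    (forall a : A, torsion a) ->
    (forall p, injective (h p)) ->
    (forall p (a : A),
       (exists v, h p v = a) <-> (exists n, a *+ (val p ^ n) = 0)) ->
  exists f : {additive A -> dirsum V}, bijective f.
Proof.
move=> torsA h_inj h_im.
have map_inj : injective (dirsum_map h).
  apply: raddf_inj => u u0; apply/val_inj/functional_extensionality_dep => q.
  have [//|uq_neq0] := eqVneq (val u q) 0.
  pose S := [set i | u i != 0].
  have finS : finite_set S by apply/asboolP; exact: dirsum_finite.
  apply: h_inj; rewrite raddf0.
  have [n qn] : exists n, h q (u q) *+ (val q ^ n) = 0.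
    by apply/h_im; exists (u q).
  have [N coN] : exists2 N, coprime (val q) N &
      (\sum_(j \in S `\ q) h j (u j)) *+ N = 0.
    rewrite fsbig_finite; last exact: finite_setD.
    rewrite big_seq.
    apply: (big_ind (fun s : A => exists2 N, coprime (val q) N & s *+ N = 0))
      => [|a b [M coM aM] [N coN bN]|j].
    - by exists 1%N; rewrite ?coprimen1.
    - exists (M * N)%N; first by rewrite coprimeMr coM.
      by rewrite mulrnDl mulrnA aM mul0rn add0r mulnC mulrnA bN mul0rn.
    rewrite in_fset_set ?inE; last exact: finite_setD.
    move=> [_ /eqP jq].
    have [k jk] : exists k, h j (u j) *+ (val j ^ k) = 0.
      by apply/h_im; exists (u j).
    exists (val j ^ k)%N => //; apply: coprimeXr.
    rewrite prime_coprime ?dvdn_prime2 ?(valP q) ?(valP j) //.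
    by rewrite val_eqE eq_sym.
  move: u0; rewrite /= (dirsum_map_widen h (S := S)) // (fsbigD1 q) //=.
  move=> /eqP; rewrite addr_eq0 => /eqP uqE sumN.
  apply: (@coprime_torsion_eq0 _ _ (val q ^ n)%N N) => //.
  - by rewrite expn_gt0 prime_gt0 // (valP q).
  - exact: coprimeXl.
  - by rewrite [h q _]uqE mulNrn sumN oppr0.
have map_surj a : exists u, dirsum_map h u = a.
  move: a (torsA a).
  apply: torsion_primary_ind => [|_ _ [u <-] [v <-]|p n a p_pr an].
  - by exists 0; rewrite raddf0.
  - by exists (u + v); rewrite raddfD.
  have [v <-] : exists v, h (exist _ p p_pr) v = a by apply/h_im; exists n.
  by exists (dirsum_single v); rewrite dirsum_map_single.
have /choice[g gK] := map_surj.
have Kg : cancel (dirsum_map h) g by move=> u; apply: map_inj; rewrite gK.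
have g_add := can2_zmod_morphism Kg gK.
pose f : {additive A -> dirsum V} :=
  HB.pack g (GRing.isZmodMorphism.Build A (dirsum V) g g_add).
by exists f; exists (dirsum_map h).
Qed.

(** * Roots of unity as values of the exponential *)

Section Circle.
Variable R : realType.
Implicit Types (x y : R) (z : circle R).

Fact exp2pii_zmod_morphism : zmod_morphism (@exp2pii R).
Proof. by move=> x y; rewrite exp2piiD exp2piiN. Qed.

HB.instance Definition _ :=
  GRing.isZmodMorphism.Build R (circle R) (@exp2pii R) exp2pii_zmod_morphism.

Lemma exp2pii_int (k : int) : exp2pii (k%:~R : R) = 0.
Proof.
have e1 : exp2pii 1 = 0 :> circle R.
  by apply/val_inj; rewrite /= mulr1 mulr_natl cos2pi sin2pi.
by rewrite raddfMz /= e1 mul0rz.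
Qed.

(** The fractional part [f] of [x] satisfies cos (2 pi f) = 1, that is
    sin (pi f) = 0, whereas the sine is positive on the open interval from 0
    to pi; so [f] is zero. *)
Lemma exp2pii_eq0 x : exp2pii x = 0 -> exists k : int, x = k%:~R.
Proof.
move=> ex0; exists (Num.floor x); apply/eqP; rewrite -subr_eq0; apply/eqP.
set f := x - _.
have /andP[f_ge0 f_lt1] : 0 <= f < 1.
  by have := floor_itv x; rewrite intrD /f; lra.
have: exp2pii f = 0 by rewrite raddfB /= ex0 exp2pii_int subr0.
move=> /(congr1 (@circle_val R)) [+ _].
rewrite -mulrA mulr_natl cos_mulr2n => cosf.
have sinf : sin (pi * f) ^+ 2 = 0 by have := cos2Dsin2 (pi * f); lra.
move: f_ge0; rewrite le_eqVlt => /orP[/eqP//|f_gt0].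
have: 0 < sin (pi * f).
  by rewrite sin_gt0_pi // mulr_gt0 ?pi_gt0 //= gtr_pMr ?pi_gt0.
by move/eqP: sinf; rewrite sqrf_eq0 => /eqP->; rewrite ltxx.
Qed.

Lemma exp2pii_surj z : exists x, exp2pii x = z.
Proof.
case: z => [[a b] nz].
have ab1 : a ^+ 2 + b ^+ 2 = 1.
  move: nz; rewrite normc_def /= => /eqP[s1].
  by rewrite -[LHS]sqr_sqrtr ?s1 ?expr1n // addr_ge0 ?sqr_ge0.
have a1 : -1 <= a <= 1 by apply/andP; split; nra.
have [_ cosa] := acos_def a1; have sina := sin_acos a1.
have sE : Num.sqrt (1 - a ^+ 2) = `|b|.
  by rewrite (_ : 1 - a ^+ 2 = b ^+ 2) ?sqrtr_sqr //; lra.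
have pi_neq0 : pi != 0 :> R by rewrite gt_eqF ?pi_gt0.
have twopiK y : 2 * pi * (y / (2 * pi)) = y.
  by rewrite mulrC divfK // mulf_neq0 // pnatr_eq0.
have [b_ge0|b_lt0] := leP 0 b.
  exists (acos a / (2 * pi)); apply/val_inj; rewrite /= twopiK cosa sina sE.
  by rewrite ger0_norm.
exists (- acos a / (2 * pi)); apply/val_inj.
by rewrite /= twopiK cosN sinN cosa sina sE ltr0_norm // opprK.
Qed.

(** If [n] kills exp (2 pi i x), then [n x] is an integer. *)
Lemma torsion_exp2pii z :
  torsion z <-> exists a : rat, z = exp2pii (ratr a).
Proof.
split=> [[n n_gt0]|[a ->]].
  have [x <-] := exp2pii_surj z; rewrite -raddfMn => /exp2pii_eq0[k xn].
  exists (k%:~R / n%:R); congr exp2pii.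
  rewrite fmorph_div /= ratr_int ratr_nat -xn -[x *+ n]mulr_natr mulfK //.
  by rewrite pnatr_eq0 -lt0n.
exists `|denq a|%N; first by rewrite absz_gt0 denq_neq0.
rewrite -raddfMn -mulr_natr -(exp2pii_int (numq a)); congr exp2pii.
rewrite natr_absz gtr0_norm ?denq_gt0 //.
by rewrite /ratr divfK // intr_eq0 denq_neq0.
Qed.

End Circle.

(** * Waves as arithmetic progressions in the circle *)

Section Waves.
Variable R : realType.
Implicit Types (theta : phase R) (a b : R) (x y : circle R).

Definition affine a b : phase R := fun m => a * m%:~R + b.

Lemma phase_closure_closed : phase_closed (@phase_closure R).
Proof.
split=> [t1 t2 C1 C2|t C1|n k t n0 kn C1] S SP; have [[SD SN Sr] _] := SP.
- by apply: SD; [exact: C1|exact: C2].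
- by apply: SN; exact: C1.
- by apply: Sr => //; exact: C1.
Qed.

(** Integer multiples come from sums and opposites; dividing by the denominator
    is the branch [k = 0] of a root. *)
Lemma phase_closure_scale (q : rat) theta :
  phase_closure theta -> phase_closure (fun m => ratr q * theta m).
Proof.
have [CD CN Cr] := phase_closure_closed; move=> Ct.
have Cext (f g : phase R) : f =1 g -> phase_closure f -> phase_closure g.
  by move=> /funext->.
have Cn n : phase_closure (fun m => n%:R * theta m).
  elim: n => [|n IHn].
    apply: (Cext (theta \+ (\- theta))) => [m /=|].
      by rewrite subrr mul0r.
    by apply: CD => //; exact: CN.
  apply: (Cext (theta \+ (fun m => n%:R * theta m))); last exact: CD.
  by move=> m /=; rewrite -natr1 mulrDl mul1r addrC.
have Cz (k : int) : phase_closure (fun m => k%:~R * theta m).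
  case: k => n; first exact: Cn.
  apply: (Cext (\- (fun m => n.+1%:R * theta m))); last first.
    by apply: CN; exact: Cn.
  by move=> m /=; rewrite NegzE mulrNz mulNr.
apply: (Cext (root_branch `|denq q| 0 (fun m => (numq q)%:~R * theta m))).
  move=> m; rewrite /root_branch addr0 natr_absz gtr0_norm ?denq_gt0 //.
  by rewrite /ratr mulrAC.
by apply: Cr => //; rewrite absz_gt0 denq_neq0.
Qed.

Lemma phase_closureE theta :
  phase_closure theta <-> exists a b : rat, theta = affine (ratr a) (ratr b).
Proof.
split=> [|[a [b ->]]]; last first.
  have [CD _ _] := phase_closure_closed.
  have CZ : phase_closure (@theta_Z R) by apply: sub_gen_smallest; left.
  have C1 : phase_closure (@theta_1 R) by apply: sub_gen_smallest; right.
  rewrite (_ : affine _ _ = (fun m => ratr a * theta_Z R m) \+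
                            (fun m => ratr b * theta_1 R m)).
    by apply: CD; exact: phase_closure_scale.
  by apply/funext => m /=; rewrite mulr1.
move: theta; apply: smallest_sub => [|theta [] ->].
- split=> [_ _ [a [b ->]] [c [d ->]]|_ [a [b ->]]|n k _ n_gt0 _ [a [b ->]]].
  + exists (a + c), (b + d); apply/funext => m.
    rewrite /affine /= !rmorphD /=; ring.
  + exists (- a), (- b); apply/funext => m.
    rewrite /affine /= !rmorphN /=; ring.
  + exists (a / n%:R), ((b + k%:R) / n%:R); apply/funext => m.
    rewrite /root_branch /affine !fmorph_div rmorphD /= !ratr_nat; ring.
- exists 1, 0; apply/funext => m.
  by rewrite /affine rmorph1 rmorph0 mul1r addr0.
- exists 0, 1; apply/funext => m.
  by rewrite /affine rmorph1 rmorph0 mul0r add0r.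
Qed.

Definition progression x y : int -> circle R := fun m => y + x *~ m.

Lemma proj_affine a b : proj (affine a b) = progression (exp2pii a) (exp2pii b).
Proof.
apply/funext => m; rewrite /proj /affine /progression -raddfMz -raddfD.
by rewrite mulrzr addrC.
Qed.

Lemma wave_closureE (u : int -> circle R) :
  u \in @wave_closure R <->
  exists x y, [/\ torsion x, torsion y & u = progression x y].
Proof.
split.
  rewrite inE => -[_ /phase_closureE[a [b ->]] <-].
  exists (exp2pii (ratr a)), (exp2pii (ratr b)); rewrite proj_affine.
  by split=> //; apply/torsion_exp2pii; eexists.
move=> [_ [_ [/torsion_exp2pii[a ->] /torsion_exp2pii[b ->] ->]]].
rewrite inE; exists (affine (ratr a) (ratr b)); last exact: proj_affine.
by apply/phase_closureE; exists a, b.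
Qed.

Lemma progression0 : progression 0 0 = 0.
Proof. by apply/funext => m; rewrite /progression mul0rz addr0. Qed.

Lemma progression_inj x y x' y' :
  progression x y = progression x' y' :> (int -> circle R) ->
  x = x' /\ y = y'.
Proof.
move=> e.
have yy' : y = y'.
  by have := congr1 (@^~ 0) e; rewrite /progression !mulr0z !addr0.
split=> //; apply: (addrI y); rewrite [in RHS]yy'.
by have := congr1 (@^~ 1) e; rewrite /progression !mulr1z.
Qed.

Lemma progressionMn (x y : circle R) n :
  progression x y *+ n = progression (x *+ n) (y *+ n).
Proof.
elim: n => [|n IHn]; apply/funext => m.
  by rewrite /progression !mulr0n mul0rz addr0.
rewrite mulrS [LHS]/(progression x y m + (progression x y *+ n) m) IHn.
by rewrite /progression !mulrS mulrzDl addrACA.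
Qed.

Lemma wave_space_torsion (u : wave_space R) : torsion u.
Proof.
have /wave_closureE[x [y [[k k_gt0 xk] [n n_gt0 yn] uE]]] := valP u.
exists (k * n)%N; first by rewrite muln_gt0 k_gt0.
apply/val_inj; rewrite raddfMn /= uE progressionMn.
by rewrite mulrnA xk mul0rn mulnC mulrnA yn mul0rn progression0.
Qed.

End Waves.

(** * The primary parts of the wave space *)

Section PrimaryPart.
Variables (R : realType) (p : nat).
Hypothesis p_gt0 : (0 < p)%N.

Lemma prufer_predE (z : circle R) :
  prufer_pred p z <-> exists n, z *+ (p ^ n) = 0.
Proof.
split=> [/asboolP[n]|[n zn]].
  rewrite unity_rootE -circle_mulrnE => /eqP zn.
  by exists n; exact/val_inj.
by apply/asboolP; exists n; rewrite unity_rootE -circle_mulrnE zn.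
Qed.

Lemma prufer_torsion (z : prufer R p) : torsion (val z).
Proof.
have /prufer_predE[n zn] := valP z.
by exists (p ^ n)%N; rewrite ?expn_gt0 ?p_gt0.
Qed.

Fact prufer_wave_subproof (z : (prufer R p * prufer R p)%type) :
  progression (val z.1) (val z.2) \in @wave_closure R.
Proof.
by apply/wave_closureE; exists (val z.1), (val z.2); split=> //;
  exact: prufer_torsion.
Qed.

Definition prufer_wave z : wave_space R :=
  @Sub _ _ (wave_space R) _ (prufer_wave_subproof z).

Lemma prufer_wave_zmod_morphism : zmod_morphism prufer_wave.
Proof.
move=> z w; apply/val_inj/funext => m.
rewrite [RHS](_ : _ = progression (val z.1) (val z.2) m
                    - progression (val w.1) (val w.2) m) //=.
by rewrite /progression mulrzBl opprD addrACA.
Qed.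

HB.instance Definition _ := GRing.isZmodMorphism.Build
  (prufer R p * prufer R p)%type (wave_space R)
  prufer_wave prufer_wave_zmod_morphism.

Lemma prufer_wave_inj : injective prufer_wave.
Proof.
move=> [x y] [x' y'] /(congr1 val) /progression_inj[/= xx' yy'].
by congr pair; exact/val_inj.
Qed.

Lemma prufer_wave_image (u : wave_space R) :
  (exists z, prufer_wave z = u) <-> (exists n, u *+ (p ^ n) = 0).
Proof.
split=> [[z <-]|[n un]].
  have /prufer_predE[n1 z1] := valP z.1; have /prufer_predE[n2 z2] := valP z.2.
  exists (n1 + n2)%N; apply/val_inj; rewrite raddfMn /= progressionMn.
  rewrite expnD mulrnA z1 mul0rn mulnC mulrnA z2 mul0rn.
  exact: progression0.
have /wave_closureE[x [y [_ _ uE]]] := valP u.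
have [xn yn] : x *+ (p ^ n) = 0 /\ y *+ (p ^ n) = 0.
  apply: progression_inj; rewrite -progressionMn -uE -raddfMn un.
  by rewrite progression0.
have px : prufer_pred p x by apply/prufer_predE; exists n.
have py : prufer_pred p y by apply/prufer_predE; exists n.
exists (@Sub _ _ (prufer R p) x px, @Sub _ _ (prufer R p) y py).
by apply/val_inj; rewrite /= uE.
Qed.

End PrimaryPart.

(** * The decomposition of the wave space *)

Theorem theorem4p3 (R : realType) :
  exists f : {additive wave_space R -> prufer_sum R}, bijective f.
Proof.
have p_gt0 (p : prime_number) : (0 < val p)%N by rewrite prime_gt0 ?(valP p).
apply: (@primary_decomposition _ _ (fun p => prufer_wave (p_gt0 p))).
- exact: wave_space_torsion.
- by move=> p; exact: prufer_wave_inj.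
- by move=> p; exact: prufer_wave_image.
Qed.
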